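(* Let $f=\frac1n\sum_{i=1}^nf_i:\mathbb{R}^d\to\mathbb{R}$ be $L$-smooth, and suppose there exist $f^*,f_1^*,\dots,f_n^*\in\mathbb{R}$ with $f(x)\ge f^*$ and $f_i(x)\ge f_i^*$ for all $x\in\mathbb{R}^d$ and all $i$. Let $g(x)$ be a stochastic gradient such that for all $x\in\mathbb{R}^d$, $\mathrm{E}[g(x)]=\nabla f(x)$, and such that for some constants $A,B,C\ge0$ and all $x\in\mathbb{R}^d$, $$\mathrm{E}\left[\|g(x)\|^2\right]\le2A(f(x)-f^* )+B\|\nabla f(x)\|^2+C .$$ Let $\mathcal{C}^P\in\mathbb{B}(\alpha)$, $w^0=x^0\in\mathbb{R}^d$, $\Delta_0:=f(x^0)-f^*$, and consider the iteration $$x^{t+1}=x^t-\gamma g(w^t),\qquad w^{t+1}=w^t+\mathcal{C}^P(x^{t+1}-w^t),\qquad t=0,1,2,\dots$$ Fix $\varepsilon>0$, let $T\ge1$ be an integer, and choose the stepsize $$\gamma=\min\left\{\frac{\alpha}{8L},\ \frac1{4BL},\ \frac1{\sqrt{2ALT}},\ \frac{\varepsilon}{16CL}\right\}.$$ Then $$T\ge\frac{48\Delta_0L}{\varepsilon}\max\left\{\frac8\alpha,\ 4B,\ \frac{96\Delta_0A}{\varepsilon},\ \frac{16C}{\varepsilon}\right\}\quad\Longrightarrow\quad\min_{0\le t\le T-1}\mathrm{E}\left[\|\nabla f(x^t)\|^2\right]\le\varepsilon .$$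
   Context: $\|\cdot\|$ is the Euclidean norm. $f$ is $L$-smooth if it is differentiable with $\|\nabla f(x)-\nabla f(y)\|\le L\|x-y\|$ for all $x,y$; $L$ denotes the smallest such number. Fractions with zero denominator in the stepsize formula are read as $+\infty$ (if the minimum is $+\infty$, any $\gamma>0$ may be used). For $\alpha\in(0,1]$, $\mathbb{B}(\alpha)$ is the set of (possibly) stochastic mappings $\mathcal{C}:\mathbb{R}^d\to\mathbb{R}^d$ with $\mathrm{E}[\|\mathcal{C}(x)-x\|^2]\le(1-\alpha)\|x\|^2$ for all $x\in\mathbb{R}^d$. The randomness of $g$ and of $\mathcal{C}^P$ is drawn independently of each other and of the past at each iteration. *)

(* Defs.v *)
From HB Require Import structures.
From mathcomp Require Import all_boot all_order all_algebra.
From mathcomp Require Import finmap.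
From mathcomp Require Import all_classical all_reals all_analysis.

Set Implicit Arguments.
Unset Strict Implicit.
Unset Printing Implicit Defensive.

Import Order.TTheory GRing.Theory Num.Theory.
Import numFieldNormedType.Exports.

Local Open Scope classical_set_scope.
Local Open Scope ring_scope.

(* The library norm `|x| on 'rV[R]_d is the sup norm, hence this definition;
   the two induce the same topology, so [differentiable] is unaffected. *)
Definition enorm (R : realType) (d : nat) (x : 'rV[R]_d) : R :=
  Num.sqrt (\sum_(i < d) (x 0 i) ^+ 2).

Definition gradient (R : realType) (d : nat) (f : 'rV[R]_d -> R)
    (x : 'rV[R]_d) : 'rV[R]_d :=
  \row_(j < d) 'D_(delta_mx 0 j) f x.

Definition lipschitz_gradient (R : realType) (d : nat) (f : 'rV[R]_d -> R)
    (L : R) : Prop :=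
  forall x y : 'rV[R]_d,
    enorm (gradient f x - gradient f y) <= L * enorm (x - y).

(* L is the smallest nonnegative smoothness constant; L = 0 is possible. *)
Definition smooth_with_constant (R : realType) (d : nat)
    (f : 'rV[R]_d -> R) (L : R) : Prop :=
  [/\ forall x : 'rV[R]_d, differentiable f x,
      0 <= L,
      lipschitz_gradient f L
    & forall L' : R, 0 <= L' -> lipschitz_gradient f L' -> L <= L'].

Notation borel_rV R d := (g_sigma_algebraType (@open 'rV[R]_d)).

(* A stochastic mapping R^d -> R^d is given by a probability space of seeds
   (S, mu) and a jointly measurable map g : S -> R^d -> R^d; the random value
   at x is g s x with s distributed according to mu.  Joint measurability makes
   g s x a random vector also when x is itself random. *)
Definition measurable_map (R : realType) (d : nat) (dS : measure_display)
    (S : measurableType dS) (g : S -> 'rV[R]_d -> 'rV[R]_d) : Prop :=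
  measurable_fun setT
    (fun p : S * borel_rV R d => (g p.1 p.2 : borel_rV R d)).

(* E[g(x)] = grad f(x) for all x, coordinatewise. *)
Definition unbiased_gradient (R : realType) (d : nat) (dS : measure_display)
    (S : measurableType dS) (mu : probability S R)
    (g : S -> 'rV[R]_d -> 'rV[R]_d) (f : 'rV[R]_d -> R) : Prop :=
  forall (x : 'rV[R]_d) (j : 'I_d),
    'E_mu[fun s => (g s x 0 j)%R]%E = (gradient f x 0 j)%:E.

Definition ABC_bound (R : realType) (d : nat) (dS : measure_display)
    (S : measurableType dS) (mu : probability S R)
    (g : S -> 'rV[R]_d -> 'rV[R]_d) (f : 'rV[R]_d -> R)
    (fstar A B C : R) : Prop :=
  forall x : 'rV[R]_d,
    ('E_mu[fun s => (enorm (g s x) ^+ 2)%R]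
      <= (2 * A * (f x - fstar) + B * enorm (gradient f x) ^+ 2 + C)%R%:E)%E.

(* The class B(alpha). *)
Definition compressor (R : realType) (d : nat) (dS : measure_display)
    (S : measurableType dS) (mu : probability S R)
    (c : S -> 'rV[R]_d -> 'rV[R]_d) (alpha : R) : Prop :=
  measurable_map c /\
  forall x : 'rV[R]_d,
    ('E_mu[fun s => (enorm (c s x - x) ^+ 2)%R]
      <= ((1 - alpha) * enorm x ^+ 2)%R%:E)%E.

(* Mutual independence of the families of events F i, i ranging over a
   possibly infinite index set. *)
Definition mutually_independent (R : realType) (dO : measure_display)
    (Omega : measurableType dO) (P : probability Omega R)
    (I : choiceType) (F : I -> set (set Omega)) : Prop :=
  forall (J : {fset I}) (E : I -> set Omega),
    (forall i, i \in J -> F i (E i)) ->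
    P (\bigcap_(i in [set` J]) E i) = (\prod_(i <- J) fine (P (E i)))%:E.

(* xi t is the seed of g and zeta t the seed of the compressor at iteration t;
   the index inl t (resp. inr t) stands for xi t (resp. zeta t). *)
Definition seed_events (R : realType) (dO d1 d2 : measure_display)
    (Omega : measurableType dO) (P : probability Omega R)
    (S1 : measurableType d1) (S2 : measurableType d2)
    (xi : nat -> {RV P >-> S1}) (zeta : nat -> {RV P >-> S2})
    (i : nat + nat) : set (set Omega) :=
  match i with
  | inl t => g_sigma_algebra_preimage (xi t)
  | inr t => g_sigma_algebra_preimage (zeta t)
  end.

Definition has_law (R : realType) (dO dS : measure_display)
    (Omega : measurableType dO) (P : probability Omega R)
    (S : measurableType dS) (mu : probability S R) (X : {RV P >-> S}) : Prop :=
  forall E : set S, measurable E -> distribution P X E = mu E.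

(* The fraction a / b, read as +oo when b = 0 (whereas a / 0 = 0 in MathComp). *)
Definition efrac (R : realType) (a b : R) : \bar R :=
  if b == 0 then +oo%E else (a / b)%:E.

Definition stepsize_min (R : realType) (alpha eps A B C L : R) (T : nat) :
    \bar R :=
  mine (efrac alpha (8 * L))
    (mine (efrac 1 (4 * B * L))
      (mine (efrac 1 (Num.sqrt (2 * A * L * T%:R)))
        (efrac eps (16 * C * L)))).

Definition stepsize (R : realType) (alpha eps A B C L : R) (T : nat)
    (gamma : R) : Prop :=
  let m := stepsize_min alpha eps A B C L T in
  (m = +oo%E -> 0 < gamma) /\ (m <> +oo%E -> gamma%:E = m).

(* Main.v *)
Require Import Defs.
From HB Require Import structures.
From mathcomp Require Import all_boot all_order all_algebra.
From mathcomp Require Import finmap ring lra.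
From mathcomp Require Import all_classical all_reals all_analysis.
From mathcomp Require Import measurable_realfun.

Import Order.TTheory GRing.Theory Num.Theory.
Import numFieldNormedType.Exports.
Local Open Scope classical_set_scope.
Local Open Scope ring_scope.

Set Implicit Arguments.
Unset Strict Implicit.

(* The Lyapunov function Phi(x, w) = f x - fstar + (L/2) |x - w|^2 satisfies, at
   every fixed pair (x, w),
     E Phi(x', w') + (gamma/2) |grad f x|^2 <= (1 + a) Phi(x, w) + L gamma^2 C
   with a = 4 gamma^2 A L <= 2 / T; the ABC bound at w is brought back to x by
   f w - fstar <= 2 (f x - fstar) + L |x - w|^2.  Since (x^t, w^t) is independent of
   the seeds of iteration t, Tonelli's theorem integrates this inequality along
   the trajectory.  All integrands are nonnegative, so that no a priori
   integrability of f(x^t) is needed.  The lower bound on T gives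
   48 Delta_0 <= eps gamma T, and if all E|grad f(x^t)|^2 with t < T exceeded
   eps, then E Phi would drop by at least (19/48) gamma eps at each step and
   become negative. *)

(** * Smooth functions and the Euclidean inner product *)

Definition dotv (R : realType) (d : nat) (u v : 'rV[R]_d) : R :=
  \sum_(i < d) u 0 i * v 0 i.

Lemma dotvC (R : realType) (d : nat) (u v : 'rV[R]_d) : dotv u v = dotv v u.
Proof. by apply: eq_bigr => i _; rewrite mulrC. Qed.

Lemma dotvDr (R : realType) (d : nat) (u v w : 'rV[R]_d) :
  dotv u (v + w) = dotv u v + dotv u w.
Proof. by rewrite -big_split; apply: eq_bigr => i _; rewrite mxE mulrDr. Qed.

Lemma dotvZr (R : realType) (d : nat) (a : R) (u v : 'rV[R]_d) :
  dotv u (a *: v) = a * dotv u v.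
Proof. by rewrite big_distrr; apply: eq_bigr => i _; rewrite mxE mulrCA. Qed.

Lemma dotvNr (R : realType) (d : nat) (u v : 'rV[R]_d) :
  dotv u (- v) = - dotv u v.
Proof. by rewrite -scaleN1r dotvZr mulN1r. Qed.

Lemma dotvDl (R : realType) (d : nat) (u v w : 'rV[R]_d) :
  dotv (u + v) w = dotv u w + dotv v w.
Proof. by rewrite dotvC dotvDr !(dotvC w). Qed.

Lemma dotvZl (R : realType) (d : nat) (a : R) (u v : 'rV[R]_d) :
  dotv (a *: u) v = a * dotv u v.
Proof. by rewrite dotvC dotvZr dotvC. Qed.

Lemma dotvNl (R : realType) (d : nat) (u v : 'rV[R]_d) :
  dotv (- u) v = - dotv u v.
Proof. by rewrite dotvC dotvNr dotvC. Qed.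

Definition dotvE := (dotvDl, dotvDr, dotvZl, dotvZr, dotvNl, dotvNr).

Lemma dotvv_ge0 (R : realType) (d : nat) (u : 'rV[R]_d) : 0 <= dotv u u.
Proof. by apply: sumr_ge0 => i _; rewrite -expr2 sqr_ge0. Qed.

Lemma enorm_sqr (R : realType) (d : nat) (u : 'rV[R]_d) :
  enorm u ^+ 2 = dotv u u.
Proof.
rewrite /enorm sqr_sqrtr; first by apply: eq_bigr => i _; rewrite expr2.
by apply: sumr_ge0 => i _; rewrite sqr_ge0.
Qed.

Lemma derive_gradient (R : realType) (d : nat) (f : 'rV[R]_d -> R)
    (x v : 'rV[R]_d) :
  differentiable f x -> 'D_v f x = dotv (gradient f x) v.
Proof.
move=> df; rewrite deriveE// [in LHS](row_sum_delta v) linear_sum.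
by apply: eq_bigr => i _; rewrite linearZ mxE deriveE// mulrC.
Qed.

Lemma lipschitz_gradient_sqr (R : realType) (d : nat) (f : 'rV[R]_d -> R)
    (L : R) (x y : 'rV[R]_d) :
  lipschitz_gradient f L ->
  dotv (gradient f x - gradient f y) (gradient f x - gradient f y)
    <= L ^+ 2 * dotv (x - y) (x - y).
Proof.
move=> fL; rewrite -!enorm_sqr -exprMn lerXn2r ?nnegrE ?sqrtr_ge0//.
by rewrite (le_trans _ (fL x y)) ?sqrtr_ge0.
Qed.

(** Expanding [0 <= dotv (u - c *: h) (u - c *: h)] gives the bound directly, in place of
    Cauchy-Schwarz; only squared norms enter. *)
Lemma dotv_le_sqr (R : realType) (d : nat) (c : R) (u h : 'rV[R]_d) :
  0 < c -> dotv u u <= c ^+ 2 * dotv h h -> dotv u h <= c * dotv h h.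
Proof.
move=> c0 uh; rewrite -(ler_pM2l c0).
have := dotvv_ge0 (u - c *: h); rewrite !dotvE (dotvC h u); lra.
Qed.

Lemma lipschitz_gradient_dotv (R : realType) (d : nat) (f : 'rV[R]_d -> R)
    (L t : R) (x h : 'rV[R]_d) :
  0 < L -> 0 < t -> lipschitz_gradient f L ->
  dotv (gradient f (x + t *: h)) h - dotv (gradient f x) h
    <= L * t * dotv h h.
Proof.
move=> L0 t0 /(lipschitz_gradient_sqr (x + t *: h) x).
rewrite addrAC subrr add0r !(dotvZl t, dotvZr t) -dotvNl -dotvDl => uL.
apply: dotv_le_sqr; first exact: mulr_gt0.
by apply: (le_trans uL); rewrite exprMn (expr2 t) !mulrA.
Qed.

(** Mean value theorem along the segment from [x] to [x + h]: the auxiliary [phi] has derivative at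
    most 0 on (0, 1), so [phi 1 <= phi 0]. This avoids integrating the gradient. *)
Lemma descent_lemma (R : realType) (d : nat) (f : 'rV[R]_d -> R) (L : R)
    (x h : 'rV[R]_d) :
  0 < L -> (forall z, differentiable f z) -> lipschitz_gradient f L ->
  f (x + h) <= f x + dotv (gradient f x) h + L / 2 * dotv h h.
Proof.
move=> L0 df fL.
pose phi (t : R) := f (x + t *: h) - dotv (gradient f x) h * t
   - L / 2 * dotv h h * t ^+ 2.
have dphi (t : R) : is_derive t 1 phi (dotv (gradient f (x + t *: h)) h
    - dotv (gradient f x) h - L * dotv h h * t).
  have d1 : is_derive t 1 (fun t : R => f (x + t *: h))
      (dotv (gradient f (x + t *: h)) h).
    rewrite -derive_gradient// deriveE//.
    have dl : is_diff t (fun t : R => x + t *: h) ( *:%R ^~ h).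
      by apply: is_diff_eq; rewrite add0r.
    have dc : is_diff t (f \o (fun t : R => x + t *: h))
        ('d f (x + t *: h) \o ( *:%R ^~ h)).
      by apply: is_diff_comp; exact: differentiableP.
    split; first exact: diff_derivable.
    by rewrite deriveE// diff_val/= scale1r.
  rewrite /phi; apply: is_derive_eq.
  move: (dotv (gradient f (x + t *: h)) h) (dotv _ h) (dotv h h) => a b c.
  by rewrite /GRing.scale/=; field.
have cphi : {within `[0, 1], continuous phi}.
  apply: continuous_subspaceT => t; apply: differentiable_continuous.
  exact/derivable1_diffP/ex_derive.
have [c + E] := MVT (@ltr01 R) (fun t _ => dphi t) cphi.
rewrite in_itv/= => /andP[c0 _]; move: E; rewrite subr0 mulr1.
have := lipschitz_gradient_dotv x h L0 c0 fL.
rewrite /phi scale1r scale0r addr0; lra.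
Qed.

(** A gradient step of length [L^-1] from [x] lowers [f] by at least |grad f x|^2 / (2L), and the
    value reached is still at least [fstar]. *)
Lemma gradient_sqr_le (R : realType) (d : nat) (f : 'rV[R]_d -> R)
    (L fstar : R) (x : 'rV[R]_d) :
  0 < L -> (forall z, differentiable f z) -> lipschitz_gradient f L ->
  (forall z, fstar <= f z) ->
  enorm (gradient f x) ^+ 2 <= 2 * L * (f x - fstar).
Proof.
move=> L0 df fL flb; rewrite enorm_sqr.
have := descent_lemma x (- (L^-1 *: gradient f x)) L0 df fL.
rewrite !dotvE; have := flb (x - L^-1 *: gradient f x).
set G := dotv _ _ => h1 h2.
have -> : G = 2 * L * (L^-1 * G - L / 2 * (L^-1 * (L^-1 * G))).
  by field; rewrite gt_eqF.
by rewrite ler_pM2l ?mulr_gt0//; lra.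
Qed.

(** * Borel measurability in R^d *)

Lemma continuous_measurable_rV (R : realType) (d : nat)
    (h : 'rV[R]_d -> R) :
  continuous h -> measurable_fun setT (h : borel_rV R d -> R).
Proof.
move=> /continuousP ch; apply: (measurability _ (RGenOpens.measurableE R)).
move=> _ [_ [a [b ->] <-]]; rewrite setTI; apply: sub_sigma_algebra.
exact/ch/interval_open.
Qed.

Lemma measurable_coord (R : realType) (d : nat) (i : 'I_d) :
  measurable_fun setT ((fun x => x 0 i) : borel_rV R d -> R).
Proof. by apply: continuous_measurable_rV; exact: coord_continuous. Qed.

(** Second countability in explicit form: the balls have indices in a countable type, so the
    preimage of an open set is a countable union of preimages of balls. *)
Lemma open_rV_bigcup_rat (R : realType) (d : nat) (U : set 'rV[R]_d) :
  open U -> U = \bigcup_(k in [set k : 'rV[rat]_d * nat |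
      ball (map_mx ratr k.1 : 'rV[R]_d) k.2.+1%:R^-1 `<=` U])
    ball (map_mx ratr k.1 : 'rV[R]_d) k.2.+1%:R^-1.
Proof.
rewrite openE => oU; apply/seteqP; split=> [x Ux|x [k kU]]; last exact: kU.
have /nbhs_ballP[e /= e0 eU] := oU _ Ux.
(* The rational centre is chosen within 1/(n+1) of [x], so every point of its ball is within 2/(n+1)
   < e of [x]. *)
have [n ne] : exists n, 2 * n.+1%:R^-1 < e.
  exists (Num.truncn (e / 2)^-1).
  by rewrite mulrC -ltr_pdivlMr// invf_plt ?posrE ?divr_gt0 ?ltr0n// truncnS_gt.
have qP (i : 'I_d) : exists q : rat, `|ratr q - x 0 i| < n.+1%:R^-1 :> R.
  have [|q] := @rat_in_itvoo R (x 0 i - n.+1%:R^-1) (x 0 i + n.+1%:R^-1).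
    by rewrite ltrD2l gtrN.
  by rewrite in_itv/= => qi; exists q; rewrite ltr_distl.
have {qP}[q qP] := choice qP.
have qx : ball (map_mx ratr (\row_i q i) : 'rV[R]_d) n.+1%:R^-1 x.
  split=> // i j; rewrite !mxE/= ord1; exact: qP.
exists (\row_i q i, n) => //= y qy; apply: eU.
apply: le_ball (ltW ne) _ _; rewrite mulr_natl mulr2n.
by apply: ball_triangle qy; exact: ball_sym.
Qed.

(** [borel_rV] is generated by the open sets, not as a product sigma-algebra. A sup norm ball is a
    box, so its preimage is a finite intersection of coordinate preimages; [open_rV_bigcup_rat]
    passes to all open sets. *)
Lemma measurable_fun_rV (R : realType) (d : nat) (dT : measure_display)
    (T : measurableType dT) (h : T -> 'rV[R]_d) :
  (forall i, measurable_fun setT (fun t => h t 0 i)) ->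
  measurable_fun setT (h : T -> borel_rV R d).
Proof.
move=> mh; apply: (@measurability _ _ _ (borel_rV R d) _ _ (@open 'rV[R]_d)) => //.
move=> _ [U oU <-]; rewrite setTI (open_rV_bigcup_rat oU) preimage_bigcup.
rewrite bigcup_mkcond; apply: countable_bigcupT_measurable => [|[q n]].
  exact: countableP.
case: ifPn => // _.
rewrite [X in measurable X](_ : _ = \bigcap_(i in [set: 'I_d])
   (fun t => h t 0 i) @^-1` ball (ratr (q 0 i) : R) n.+1%:R^-1).
  apply: fin_bigcap_measurable => // i _.
  by rewrite -[X in measurable X]setTI; apply: mh => //; exact: measurable_ball.
apply/seteqP; split => [t [_ qt] i _|t qt].
  by have := qt 0 i; rewrite mxE.
split => // i j; rewrite ord1 mxE; exact: qt.
Qed.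

Lemma measurable_funD_rV (R : realType) (d : nat) (dT : measure_display)
    (T : measurableType dT) (h k : T -> 'rV[R]_d) :
  measurable_fun setT (h : T -> borel_rV R d) ->
  measurable_fun setT (k : T -> borel_rV R d) ->
  measurable_fun setT ((fun t => h t + k t) : T -> borel_rV R d).
Proof.
move=> mh mk; apply: measurable_fun_rV => i.
rewrite (_ : (fun _ => _) = (fun t => h t 0 i + k t 0 i)); last first.
  by apply/funext => t; rewrite mxE.
apply: measurable_funD.
- exact: (measurableT_comp (measurable_coord i) mh).
- exact: (measurableT_comp (measurable_coord i) mk).
Qed.

Lemma measurable_funZ_rV (R : realType) (d : nat) (dT : measure_display)
    (T : measurableType dT) (a : R) (h : T -> 'rV[R]_d) :
  measurable_fun setT (h : T -> borel_rV R d) ->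
  measurable_fun setT ((fun t => a *: h t) : T -> borel_rV R d).
Proof.
move=> mh; apply: measurable_fun_rV => i.
rewrite (_ : (fun _ => _) = (fun t => a * h t 0 i)); last first.
  by apply/funext => t; rewrite mxE.
apply: measurable_funM => //.
exact: (measurableT_comp (measurable_coord i) mh).
Qed.

Lemma measurable_funB_rV (R : realType) (d : nat) (dT : measure_display)
    (T : measurableType dT) (h k : T -> 'rV[R]_d) :
  measurable_fun setT (h : T -> borel_rV R d) ->
  measurable_fun setT (k : T -> borel_rV R d) ->
  measurable_fun setT ((fun t => h t - k t) : T -> borel_rV R d).
Proof.
move=> mh mk; apply: measurable_funD_rV => //.
rewrite (_ : (fun _ => _) = (fun t => -1 *: k t)); last first.
  by apply/funext => t; rewrite scaleN1r.
exact: measurable_funZ_rV.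
Qed.

Lemma measurable_enorm_sqr (R : realType) (d : nat) (dT : measure_display)
    (T : measurableType dT) (h : T -> 'rV[R]_d) :
  measurable_fun setT (h : T -> borel_rV R d) ->
  measurable_fun setT (fun t => enorm (h t) ^+ 2).
Proof.
move=> mh; rewrite (_ : (fun _ => _) = (fun t => \sum_(i < d) h t 0 i ^+ 2)).
  apply: measurable_sum => i; apply: measurable_funX.
  exact: (measurableT_comp (measurable_coord i) mh).
apply/funext => t; rewrite sqr_sqrtr//.
by apply: sumr_ge0 => i _; rewrite sqr_ge0.
Qed.

(** Serves to turn the Euclidean Lipschitz bound into continuity for the library topology, whose
    balls are those of the sup norm. *)
Lemma enorm_le_norm (R : realType) (d : nat) (x : 'rV[R]_d) :
  enorm x <= Num.sqrt d%:R * `|x|.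
Proof.
rewrite -[X in _ * X]ger0_norm// -sqrtr_sqr -sqrtrM// ler_sqrt; last first.
  by rewrite mulr_ge0// sqr_ge0.
rewrite mulr_natl -[X in _ *+ X]card_ord -sumr_const.
apply: ler_sum => i _; rewrite -(real_normK (num_real _)) lerXn2r ?nnegrE//.
by rewrite [leRHS]mx_normrE (le_bigmax _ (fun ij => `|x ij.1 ij.2|) (0, i)).
Qed.

Lemma lipschitz_gradient_continuous (R : realType) (d : nat)
    (f : 'rV[R]_d -> R) (L : R) (i : 'I_d) :
  0 <= L -> lipschitz_gradient f L ->
  continuous (fun x => gradient f x 0 i).
Proof.
move=> L0 fL x.
apply/(@cvgrPdist_le _ _ _ _ (nbhs_filter (x : 'rV[R]_d))) => e e0.
(* The summand 1 keeps [K] positive when [L = 0], so that [e / K] is a valid radius. *)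
pose K := L * Num.sqrt d%:R + 1.
have K0 : 0 < K by rewrite ltr_wpDl// mulr_ge0// sqrtr_ge0.
near=> y.
have -> : gradient f x 0 i - gradient f y 0 i = (gradient f x - gradient f y) 0 i.
  by rewrite !mxE.
apply: (@le_trans _ _ (enorm (gradient f x - gradient f y))).
  rewrite -sqrtr_sqr ler_wsqrtr// (bigD1 i)//= lerDl.
  by apply: sumr_ge0 => j _; rewrite sqr_ge0.
apply: (le_trans (fL x y)).
apply: (@le_trans _ _ (K * `|x - y|)).
  rewrite (le_trans (ler_wpM2l L0 (enorm_le_norm _)))// mulrA ler_wpM2r//.
  by rewrite lerDl.
rewrite mulrC -ler_pdivlMr//; near: y.
apply/nbhs_ballP; exists (e / K); first exact: divr_gt0.
by move=> y; rewrite mx_norm_ball => /ltW.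
Unshelve. all: by end_near. Qed.

Lemma measurable_gradient (R : realType) (d : nat)
    (f : 'rV[R]_d -> R) (L : R) :
  0 <= L -> lipschitz_gradient f L ->
  measurable_fun setT (gradient f : borel_rV R d -> borel_rV R d).
Proof.
move=> L0 fL; apply: measurable_fun_rV => i; apply: continuous_measurable_rV.
exact: lipschitz_gradient_continuous fL.
Qed.

(** * Independence of the state from the later seeds *)

(* Conditioning on G reduces this to the uniqueness of the product measure. *)
Lemma product_law_event (R : realType) (dO d1 d2 : measure_display)
    (Omega : measurableType dO) (P : probability Omega R)
    (T1 : measurableType d1) (T2 : measurableType d2)
    (m1 : probability T1 R) (m2 : probability T2 R)
    (X : Omega -> T1) (Y : Omega -> T2) (G : set Omega) (D : set (T1 * T2)) :
  measurable_fun setT X -> measurable_fun setT Y -> measurable G ->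
  (forall U V, measurable U -> measurable V ->
     P (X @^-1` U `&` (Y @^-1` V `&` G)) = (m1 U * (m2 V * P G))%E) ->
  measurable D ->
  P ((fun o => (X o, Y o)) @^-1` D `&` G) = ((m1 \x m2)%E D * P G)%E.
Proof.
move=> mX mY mG XYG mD.
pose XY := HB.pack_for {mfun Omega >-> (T1 * T2)%type} (fun o => (X o, Y o))
  (isMeasurableFun.Build _ _ _ _ _ (measurable_fun_pair mX mY)).
(* Given a null event there is no conditional law, but then both sides are 0. *)
have [PG0|PG0] := eqVneq (P G) 0%E.
  rewrite PG0 mule0; apply: (subset_measure0 _ _ _ PG0) => //.
  by apply: measurableI => //; exact: (measurable_funPTI XY).
have PGfin : P G \is a fin_num by exact: fin_num_measure.
have r0 : 0 <= (fine (P G))^-1 by rewrite invr_ge0 fine_ge0.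
have rG : ((fine (P G))^-1%:E * P G = 1)%E.
  by rewrite -[X in (_ * X)%E]fineK// -EFinM mulVf// fine_eq0.
have Q1 : mscale (NngNum r0) (mrestr P mG) setT = 1%E.
  by rewrite /mscale/= /mrestr setTI rG.
pose Q := HB.pack_for (probability Omega R) (mscale (NngNum r0) (mrestr P mG))
  (Measure_isProbability.Build _ _ _ _ Q1).
have QE A : distribution Q XY A = ((fine (P G))^-1%:E * P (XY @^-1` A `&` G))%E.
  by [].
have E : forall A B, measurable A -> measurable B ->
    distribution Q XY (A `*` B) = (m1 A * m2 B)%E.
  move=> A B mA mB; rewrite QE.
  rewrite (_ : _ `&` G = X @^-1` A `&` (Y @^-1` B `&` G)); last first.
    by rewrite setIA.
  by rewrite XYG// muleCA (muleCA _ (m2 B)) rG mule1.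
have -> : ((m1 \x m2) D = (fine (P G))^-1%:E * P (XY @^-1` D `&` G))%E.
  exact: product_measure_unique E _ mD.
by rewrite muleAC rG mul1e.
Qed.

(** The hypothesis on rectangles identifies the joint law of [(X, Y)] with the product of the law of
    [X] and [m2]; Tonelli then splits the integral. *)
Lemma ge0_integral_independent (R : realType) (dO d1 d2 : measure_display)
    (Omega : measurableType dO) (P : probability Omega R)
    (T1 : measurableType d1) (T2 : measurableType d2)
    (m2 : probability T2 R) (X : Omega -> T1) (Y : Omega -> T2)
    (h : T1 * T2 -> \bar R) :
  measurable_fun setT X -> measurable_fun setT Y ->
  (forall U V, measurable U -> measurable V ->
     P (X @^-1` U `&` Y @^-1` V) = (P (X @^-1` U) * m2 V)%E) ->
  measurable_fun setT h -> (forall z, 0 <= h z)%E ->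
  (\int[P]_o h (X o, Y o) = \int[P]_o \int[m2]_y h (X o, y))%E.
Proof.
move=> mX mY XY mh h0.
pose Xm := HB.pack_for {mfun Omega >-> T1} X (isMeasurableFun.Build _ _ _ _ _ mX).
pose XYm := HB.pack_for {mfun Omega >-> (T1 * T2)%type} (fun o => (X o, Y o))
  (isMeasurableFun.Build _ _ _ _ _ (measurable_fun_pair mX mY)).
transitivity (\int[distribution P XYm]_z h z)%E.
  by rewrite ge0_integral_distribution.
transitivity (\int[distribution P Xm \x m2]_z h z)%E.
  apply: eq_measure_integral => A mA _; apply/esym.
  by apply: product_measure_unique => // U V mU mV; exact: XY.
rewrite fubini_tonelli1// ge0_integral_distribution//.
  exact: measurable_fun_fubini_tonelli_F.
by move=> x; apply: integral_ge0 => y _; exact: h0.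
Qed.

(* The independence of the state at time t from the future is proved on these
   events only, not on the sigma-algebra that they generate. *)
Definition future_event (R : realType) (dO d1 d2 : measure_display)
    (Omega : measurableType dO) (P : probability Omega R)
    (S1 : measurableType d1) (S2 : measurableType d2)
    (xi : nat -> {RV P >-> S1}) (zeta : nat -> {RV P >-> S2})
    (t : nat) (G : set Omega) : Prop :=
  exists (J : {fset (nat + nat)}) (E : nat + nat -> set Omega),
  [/\ forall i, i \in J -> seed_events xi zeta i (E i),
      forall i, i \in J -> (t <= match i with inl s => s | inr s => s end)%N
    & G = \bigcap_(i in [set` J]) E i].

Lemma future_event_measurable (R : realType) (dO d1 d2 : measure_display)
    (Omega : measurableType dO) (P : probability Omega R)
    (S1 : measurableType d1) (S2 : measurableType d2)
    (xi : nat -> {RV P >-> S1}) (zeta : nat -> {RV P >-> S2})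
    (t : nat) (G : set Omega) :
  future_event xi zeta t G -> measurable G.
Proof.
move=> [J [E [JE _ ->]]]; apply: fin_bigcap_measurable => // i iJ.
have := JE i iJ; case: i {iJ} => s /= [U mU <-];
  by rewrite setTI; exact: measurable_funPTI.
Qed.

(** The indices behind [G] are at least [t.+1], so the two seeds of iteration [t] are fresh;
    adjoining them to the finite family splits two factors off the product formula. *)
Lemma future_event_cons (R : realType) (dO d1 d2 : measure_display)
    (Omega : measurableType dO) (P : probability Omega R)
    (S1 : measurableType d1) (S2 : measurableType d2)
    (mu1 : probability S1 R) (mu2 : probability S2 R)
    (xi : nat -> {RV P >-> S1}) (zeta : nat -> {RV P >-> S2})
    (t : nat) (G : set Omega) (U : set S1) (V : set S2) :
  (forall t, has_law mu1 (xi t)) -> (forall t, has_law mu2 (zeta t)) ->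
  mutually_independent P (seed_events xi zeta) ->
  future_event xi zeta t.+1 G -> measurable U -> measurable V ->
  let G' := xi t @^-1` U `&` (zeta t @^-1` V `&` G) in
  future_event xi zeta t G' /\ P G' = (mu1 U * (mu2 V * P G))%E.
Proof.
move=> xi_law zeta_law indep [J [E [JE Jt ->]]] mU mV G'.
(* [E] is unconstrained outside [J], so its values at the two new indices are overwritten. *)
pose E' i := if i == inl t then xi t @^-1` U
             else if i == inr t then zeta t @^-1` V else E i.
have tJ i : i \in J -> (i == inl t = false) /\ (i == inr t = false).
  by move=> /Jt; case: i => s /= ts; split; apply/eqP => //= -[st]; move: ts; rewrite st ltnn.
have E'J i : i \in J -> E' i = E i by move=> /tJ; rewrite /E' => -[-> ->].
pose J' := (inl t |` (inr t |` J))%fset.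
have E'P i : i \in J' -> seed_events xi zeta i (E' i).
  rewrite !inE => /or3P[/eqP->|/eqP->|iJ]; last by rewrite E'J//; exact: JE.
  - by rewrite /E' eqxx/=; exists U; rewrite ?setTI.
  - by rewrite /E'/= eqxx; exists V; rewrite ?setTI.
have capJ : \bigcap_(i in [set` J]) E' i = \bigcap_(i in [set` J]) E i.
  by apply: eq_bigcapr => i iJ; exact: E'J.
have capJ' : G' = \bigcap_(i in [set` J']) E' i.
  rewrite /J' /G' !set_fsetU1 !bigcap_setU !bigcap_set1 capJ /E' eqxx.
  by rewrite (_ : inr t == inl t = false)// eqxx.
split.
  exists J', E'; split => // i; rewrite !inE => /or3P[/eqP->|/eqP->|/Jt]//.
  exact: ltnW.
have PE (Z : set Omega) : measurable Z -> (fine (P Z))%:E = P Z.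
  by move=> mZ; rewrite fineK// fin_num_measure.
rewrite capJ' -capJ !indep//; last first.
  by move=> i iJ; rewrite E'J//; exact: JE.
have notin_r : inr t \notin J by apply/negP => /tJ[_]; rewrite eqxx.
have notin_l : inl t \notin (inr t |` J)%fset.
  by rewrite !inE/=; apply/negP => /tJ[]; rewrite eqxx.
rewrite /J' !big_fsetU1//= !EFinM; congr (_ * (_ * _))%E.
- rewrite /E' eqxx PE; last by exact: measurable_funPTI.
  by rewrite -(xi_law t).
- rewrite /E'/= eqxx PE; last by exact: measurable_funPTI.
  by rewrite -(zeta_law t).
Qed.

Lemma future_eventT (R : realType) (dO d1 d2 : measure_display)
    (Omega : measurableType dO) (P : probability Omega R)
    (S1 : measurableType d1) (S2 : measurableType d2)
    (xi : nat -> {RV P >-> S1}) (zeta : nat -> {RV P >-> S2}) (t : nat) :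
  future_event xi zeta t setT.
Proof.
exists fset0, (fun=> setT); split => //.
by rewrite set_fset0 bigcap_set0.
Qed.

(** [product_law_event] extends the factorisation from rectangles to every measurable [W], the
    conditioning event being that [Z] lies in [D] and [G] occurs. On rectangles, the seed events are
    absorbed into the future event and the hypothesis on [Z] applies. *)
Lemma seeds_law_event (R : realType) (dO d1 d2 dZ : measure_display)
    (Omega : measurableType dO) (P : probability Omega R)
    (S1 : measurableType d1) (S2 : measurableType d2)
    (mu1 : probability S1 R) (mu2 : probability S2 R)
    (xi : nat -> {RV P >-> S1}) (zeta : nat -> {RV P >-> S2})
    (TZ : measurableType dZ) (Z : {RV P >-> TZ}) (t : nat) (G : set Omega)
    (D : set TZ) (W : set (S1 * S2)) :
  (forall t, has_law mu1 (xi t)) -> (forall t, has_law mu2 (zeta t)) ->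
  mutually_independent P (seed_events xi zeta) ->
  (forall D G, measurable D -> future_event xi zeta t G ->
     P (Z @^-1` D `&` G) = (P (Z @^-1` D) * P G)%E) ->
  future_event xi zeta t.+1 G -> measurable D -> measurable W ->
  P (Z @^-1` D `&` ((fun o => (xi t o, zeta t o)) @^-1` W `&` G))
    = (P (Z @^-1` D) * ((mu1 \x mu2) W * P G))%E.
Proof.
move=> xi_law zeta_law indep ZG futG mD mW.
have ZD G' : future_event xi zeta t.+1 G' ->
    P (Z @^-1` D `&` G') = (P (Z @^-1` D) * P G')%E.
  case=> J [E [JE Jt ->]]; apply: ZG => //; exists J, E; split => // i /Jt.
  exact: ltnW.
rewrite setICA (@product_law_event _ _ _ _ _ _ _ _ mu1 mu2)//.
- by rewrite ZD// muleCA.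
- apply: measurableI; first exact: measurable_funPTI.
  exact: future_event_measurable futG.
- move=> U V mU mV.
  have [futG' PG'] := future_event_cons xi_law zeta_law indep futG mU mV.
  rewrite (setICA (zeta t @^-1` V)) (setICA (xi t @^-1` U)) ZG// PG' ZD//.
  by rewrite muleCA (muleCA _ (mu2 V)).
Qed.

(** Induction on [t] that carries independence from all future events: the next state is a function
    of the current state and its two seeds, and the joint law of these three is a product measure
    that also factors from every later event. *)
Lemma markov_chain_independent (R : realType) (dO d1 d2 dZ : measure_display)
    (Omega : measurableType dO) (P : probability Omega R)
    (S1 : measurableType d1) (S2 : measurableType d2)
    (mu1 : probability S1 R) (mu2 : probability S2 R)
    (xi : nat -> {RV P >-> S1}) (zeta : nat -> {RV P >-> S2})
    (TZ : measurableType dZ) (F : TZ * (S1 * S2) -> TZ) (z0 : TZ)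
    (Z : nat -> Omega -> TZ) (t : nat) :
  (forall t, has_law mu1 (xi t)) -> (forall t, has_law mu2 (zeta t)) ->
  mutually_independent P (seed_events xi zeta) ->
  measurable_fun setT F -> (forall o, Z 0%N o = z0) ->
  (forall t o, Z t.+1 o = F (Z t o, (xi t o, zeta t o))) ->
  measurable_fun setT (Z t) /\
  (forall D G, measurable D -> future_event xi zeta t G ->
     P (Z t @^-1` D `&` G) = (P (Z t @^-1` D) * P G)%E).
Proof.
move=> xi_law zeta_law indep mF Z0 ZS; elim: t => [|t [mZ ZG]].
  (* The initial state is constant, so its preimages are [setT] or empty. *)
  rewrite (_ : Z 0%N = cst z0); last exact/funext.
  split=> [|D G mD futG]; first exact: measurable_cst.
  rewrite preimage_cst; case: ifPn => _.
    by rewrite setTI probability_setT mul1e.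
  by rewrite set0I measure0 mul0e.
have mxz : measurable_fun setT (fun o => (xi t o, zeta t o)).
  exact: measurable_fun_pair.
have -> : Z t.+1 = F \o (fun o => (Z t o, (xi t o, zeta t o))).
  exact/funext.
split=> [|D G mD futG].
  by apply: measurableT_comp => //; exact: measurable_fun_pair.
pose Zm := HB.pack_for {RV P >-> TZ} (Z t) (isMeasurableFun.Build _ _ _ _ _ mZ).
have mFD : measurable (F @^-1` D) by rewrite -[X in measurable X]setTI; exact: mF.
have law G' : future_event xi zeta t.+1 G' ->
    P ((fun o => (Z t o, (xi t o, zeta t o))) @^-1` (F @^-1` D) `&` G')
    = ((distribution P Zm \x (mu1 \x mu2)) (F @^-1` D) * P G')%E.
  move=> futG'; apply: product_law_event => //.
    exact: future_event_measurable futG'.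
  move=> U W mU mW.
  exact: (@seeds_law_event _ _ _ _ _ _ _ _ _ mu1 mu2 xi zeta _ Zm t).
rewrite law//; congr (_ * _)%E.
(* With [setT] as future event, [law] says that the product measure in question is the probability
   that [Z t.+1] lies in [D]. *)
by have := law _ (future_eventT xi zeta t.+1); rewrite setIT probability_setT mule1.
Qed.

(** This replaces the tower property: the seeds are integrated out at a frozen state, without
    conditional expectations. *)
Lemma ge0_integral_markov_chain (R : realType) (dO d1 d2 dZ : measure_display)
    (Omega : measurableType dO) (P : probability Omega R)
    (S1 : measurableType d1) (S2 : measurableType d2)
    (mu1 : probability S1 R) (mu2 : probability S2 R)
    (xi : nat -> {RV P >-> S1}) (zeta : nat -> {RV P >-> S2})
    (TZ : measurableType dZ) (F : TZ * (S1 * S2) -> TZ) (z0 : TZ)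
    (Z : nat -> Omega -> TZ) (t : nat) (h : TZ -> \bar R) :
  (forall t, has_law mu1 (xi t)) -> (forall t, has_law mu2 (zeta t)) ->
  mutually_independent P (seed_events xi zeta) ->
  measurable_fun setT F -> (forall o, Z 0%N o = z0) ->
  (forall t o, Z t.+1 o = F (Z t o, (xi t o, zeta t o))) ->
  measurable_fun setT h -> (forall z, 0 <= h z)%E ->
  (\int[P]_o h (Z t.+1 o)
   = \int[P]_o \int[mu1]_s1 \int[mu2]_s2 h (F (Z t o, (s1, s2))))%E.
Proof.
move=> xi_law zeta_law indep mF Z0 ZS mh h0.
have [mZ ZG] := markov_chain_independent t xi_law zeta_law indep mF Z0 ZS.
pose Zm := HB.pack_for {RV P >-> TZ} (Z t) (isMeasurableFun.Build _ _ _ _ _ mZ).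
have mhF : measurable_fun setT (h \o F) by exact: measurableT_comp.
under eq_integral do rewrite ZS.
rewrite (@ge0_integral_independent _ _ _ _ _ _ _ _ (mu1 \x mu2)%E (Z t)
  (fun o => (xi t o, zeta t o)) (h \o F))//=.
- apply: eq_integral => o _.
  rewrite (@fubini_tonelli1 _ _ _ _ _ mu1 mu2 (fun s => h (F (Z t o, s))))//.
  exact: (measurable_fun_pair2 (Z t o) mhF).
- exact: measurable_fun_pair.
- move=> U W mU mW.
  have := @seeds_law_event _ _ _ _ _ _ _ _ _ mu1 mu2 xi zeta _ Zm t setT U W
    xi_law zeta_law indep ZG (future_eventT xi zeta t.+1) mU mW.
  by rewrite setIT probability_setT mule1.
Qed.

Lemma measurable_iterated_integral (R : realType) (d1 d2 dZ : measure_display)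
    (S1 : measurableType d1) (S2 : measurableType d2) (TZ : measurableType dZ)
    (mu1 : probability S1 R) (mu2 : probability S2 R)
    (h : TZ * (S1 * S2) -> \bar R) :
  measurable_fun setT h -> (forall z, 0 <= h z)%E ->
  measurable_fun setT
    (fun z => \int[mu1]_s1 \int[mu2]_s2 h (z, (s1, s2)))%E.
Proof.
move=> mh h0.
(* Reassociating the product as [(TZ * S1) * S2] makes [mu2], and after it [mu1], the inner measure
   of a Tonelli pair. *)
pose k (p : (TZ * S1) * S2) := h (p.1.1, (p.1.2, p.2)).
have mk : measurable_fun setT k.
  apply: (measurableT_comp mh); apply: measurable_fun_pair.
    exact: (measurableT_comp measurable_fst measurable_fst).
  apply: measurable_fun_pair => //.
  exact: (measurableT_comp measurable_snd measurable_fst).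
have mk2 := measurable_fun_fubini_tonelli_F (m2 := mu2) k mk (fun p => h0 _).
apply: (measurable_fun_fubini_tonelli_F (m2 := mu1) (fubini_F mu2 k)) => //.
by move=> p; apply: integral_ge0 => s _; exact: h0.
Qed.

(** * One step of the iteration *)

Definition lyapunov (R : realType) (d : nat) (f : 'rV[R]_d -> R)
    (fstar L : R) (z : borel_rV R d * borel_rV R d) : R :=
  f z.1 - fstar + L / 2 * enorm (z.1 - z.2) ^+ 2.

Lemma lyapunov_ge0 (R : realType) (d : nat) (f : 'rV[R]_d -> R)
    (fstar L : R) (z : borel_rV R d * borel_rV R d) :
  0 <= L -> (forall x, fstar <= f x) -> 0 <= lyapunov f fstar L z.
Proof.
move=> L0 flb; rewrite addr_ge0 ?subr_ge0// mulr_ge0 ?sqr_ge0//.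
by rewrite divr_ge0.
Qed.

Lemma measurable_lyapunov (R : realType) (d : nat) (f : 'rV[R]_d -> R)
    (fstar L : R) :
  (forall x, differentiable f x) -> measurable_fun setT (lyapunov f fstar L).
Proof.
move=> df; apply: measurable_funD; last first.
  apply: measurable_funM => //; apply: measurable_enorm_sqr.
  exact: measurable_funB_rV.
apply: measurable_funB => //.
apply: (measurableT_comp (continuous_measurable_rV _)) => // x.
exact: differentiable_continuous.
Qed.

(** Here [x] is the iterate already updated. Its distance to the new [w] is the norm of the
    compression error of [x - w], so the factor [1 - alpha] acts on it directly. *)
Lemma compressor_step (R : realType) (d : nat) (dS : measure_display)
    (S : measurableType dS) (mu : probability S R)
    (c : S -> 'rV[R]_d -> 'rV[R]_d) (alpha : R) (f : 'rV[R]_d -> R)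
    (fstar L : R) (x w : 'rV[R]_d) :
  compressor mu c alpha -> 0 <= L -> (forall x, fstar <= f x) ->
  (\int[mu]_s (lyapunov f fstar L (x, w + c s (x - w)))%:E
    <= (f x - fstar + L / 2 * ((1 - alpha) * enorm (x - w) ^+ 2))%:E)%E.
Proof.
move=> [mc cA] L0 flb.
have mcz : measurable_fun setT (fun s => enorm (c s (x - w) - (x - w)) ^+ 2).
  apply: measurable_enorm_sqr; apply: measurable_funB_rV => //.
  exact: (measurable_fun_pair1 (x - w : borel_rV R d) mc).
under eq_integral => s _.
  rewrite /lyapunov/= (_ : enorm _ ^+ 2 = enorm (c s (x - w) - (x - w)) ^+ 2); last first.
    rewrite !enorm_sqr (_ : x - (w + c s (x - w)) = - (c s (x - w) - (x - w))); last first.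
      by rewrite opprB opprD addrA.
    by rewrite dotvNl dotvNr opprK.
  rewrite EFinD EFinM.
  over.
rewrite ge0_integralD//=; last 3 first.
- by move=> s _; rewrite lee_fin subr_ge0.
- by move=> s _; rewrite -EFinM lee_fin mulr_ge0 ?sqr_ge0 ?divr_ge0.
- by apply/measurable_EFinP; exact: measurable_funM.
rewrite integral_cst//= probability_setT mule1 ge0_integralZl_EFin//=; last 3 first.
- by move=> s _; rewrite lee_fin sqr_ge0.
- exact/measurable_EFinP.
- by rewrite divr_ge0.
rewrite [leRHS]EFinD leeD2l// [leRHS]EFinM lee_wpmul2l ?lee_fin ?divr_ge0//.
by have := cA (x - w); rewrite unlock.
Qed.

(** The linear term has no sign, so genuine integrability is required here; it comes from the second
    moment bound [M]. *)
Lemma expectation_quadratic_le (R : realType) (d : nat) (dS : measure_display)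
    (S : measurableType dS) (mu : probability S R)
    (X : S -> 'rV[R]_d) (m K1 : 'rV[R]_d) (K0 K2 M : R) :
  measurable_fun setT (X : S -> borel_rV R d) ->
  (forall j, \int[mu]_s (X s 0 j)%:E = (m 0 j)%:E)%E ->
  (\int[mu]_s (enorm (X s) ^+ 2)%:E <= M%:E)%E -> 0 <= K2 ->
  (\int[mu]_s (K0 + dotv K1 (X s) + K2 * enorm (X s) ^+ 2)%:E
    <= (K0 + dotv K1 m + K2 * M)%:E)%E.
Proof.
move=> mX Xm XM K20.
have mN : measurable_fun setT (fun s => enorm (X s) ^+ 2).
  exact: measurable_enorm_sqr.
have iN : mu.-integrable setT (fun s => (enorm (X s) ^+ 2)%:E).
  apply/integrableP; split; first exact/measurable_EFinP.
  under eq_integral do rewrite gee0_abs ?lee_fin ?sqr_ge0//.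
  exact: le_lt_trans XM (ltry _).
have i1 (r : R) : mu.-integrable setT (fun=> r%:E).
  exact: finite_measure_integrable_cst.
have mXj j : measurable_fun setT (fun s => X s 0 j).
  exact: (measurableT_comp (measurable_coord j) mX).
have iX j : mu.-integrable setT (fun s => (X s 0 j)%:E).
  apply: (@le_integrable _ _ _ mu _ _ _ (fun s => (1 + enorm (X s) ^+ 2)%:E)) => //.
  - exact/measurable_EFinP.
  - move=> s _; rewrite lee_fin (ger0_norm (addr_ge0 _ _)) ?sqr_ge0//.
    (* |y| <= 1 + y^2 follows from (|y| - 1)^2 >= 0; then y^2 is one summand of the squared norm. *)
    apply: (@le_trans _ _ (1 + X s 0 j ^+ 2)).
      rewrite -(real_normK (num_real (X s 0 j))).
      have := sqr_ge0 (`|X s 0 j| - 1); nra.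
    rewrite lerD2l enorm_sqr /dotv (bigD1 j)//= -expr2 lerDl.
    by apply: sumr_ge0 => i _; rewrite -expr2 sqr_ge0.
  - exact: (integrableD measurableT (i1 1) iN).
have iKX j : mu.-integrable setT (fun s => (K1 0 j)%:E * (X s 0 j)%:E)%E.
  exact: integrableZl.
have idot : mu.-integrable setT (fun s => (dotv K1 (X s))%:E).
  rewrite (_ : (fun _ => _) = (fun s => \sum_(j < d) (K1 0 j)%:E * (X s 0 j)%:E)%E).
    exact: integrable_sum.
  by apply/funext => s; rewrite /dotv -sumEFin.
have iK0 : mu.-integrable setT (fun s => (K0 + dotv K1 (X s))%:E).
  exact: (integrableD measurableT (i1 K0) idot).
have iKN : mu.-integrable setT (fun s => (K2 * enorm (X s) ^+ 2)%:E).
  exact: (integrableZl measurableT K2 iN).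
under eq_integral do rewrite EFinD.
rewrite integralD// EFinD leeD//.
  under eq_integral do rewrite EFinD.
  rewrite integralD// integral_cst//= probability_setT mule1 EFinD leeD2l//.
  under eq_integral => s _ do rewrite /dotv -sumEFin.
  rewrite integral_sum// /dotv -sumEFin; apply: lee_sum => j _.
  by under eq_integral do rewrite EFinM; rewrite integralZl// Xm.
under eq_integral do rewrite EFinM.
by rewrite integralZl// EFinM lee_wpmul2l.
Qed.

(** Scalar core of [one_step]. [F] and [Fw] are the gaps of [f] to [fstar] at [x] and [w]; [G], [H],
    [D] are the squared norms of grad f x, of grad f w and of their difference; [r] is |x - w|^2;
    [p] and [c] are the inner products of grad f w with grad f x and with x - w; [M] is the ABC
    bound at [w]. *)
Lemma one_step_real (R : realFieldType) (F Fw G H D r p c M L A B C alpha gamma : R) :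
  0 < L -> 0 < gamma -> 0 < alpha -> alpha <= 1 -> 0 <= A -> 0 <= B -> 0 <= C ->
  8 * L * gamma <= alpha -> 4 * B * L * gamma <= 1 ->
  0 <= r -> 0 <= H -> 0 <= Fw ->
  D <= L ^+ 2 * r -> D = G + H - 2 * p ->
  0 <= alpha ^+ 2 / 4 * r + alpha * gamma * c + gamma ^+ 2 * H ->
  Fw <= 2 * F + L * r -> M = 2 * A * Fw + B * H + C ->
  F - gamma * p + L / 2 * ((1 - alpha) * (r - 2 * gamma * c))
    + L * gamma ^+ 2 / 2 * (2 - alpha) * M + gamma / 2 * G
  <= (1 + 4 * gamma ^+ 2 * A * L) * (F + L / 2 * r) + L * gamma ^+ 2 * C.
Proof.
move=> L0 g0 a0 a1 A0 B0 C0 ga gB r0 H0 Fw0 Dle DE cge Fwle ME.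
have [L0' g0' a0'] : [/\ 0 <= L, 0 <= gamma & 0 <= alpha] by rewrite !ltW.
have M0 : 0 <= M by rewrite ME !addr_ge0// !mulr_ge0.
(* Polarization: [p = (G + H - D) / 2]. *)
have h1 : - (gamma * p) <= - (gamma / 2 * G) - gamma / 2 * H + gamma / 2 * (L ^+ 2 * r).
  have : gamma / 2 * D <= gamma / 2 * (L ^+ 2 * r) by rewrite ler_wpM2l// divr_ge0//.
  rewrite DE; lra.
(* Young's inequality with weight [alpha / 2] on the cross term, then [(1 - alpha) * (1 + alpha / 2)
   <= 1 - alpha / 2]. *)
have h2 : (1 - alpha) * (r - 2 * gamma * c)
    <= (1 - alpha / 2) * r + 2 * gamma ^+ 2 * H / alpha.
  have h : - (2 * gamma * c) <= alpha / 2 * r + 2 * gamma ^+ 2 * H / alpha.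
    rewrite -(ler_pM2l a0) mulrDr (mulrC alpha (_ / alpha)) divfK ?gt_eqF//; lra.
  have q0 : 0 <= 2 * gamma ^+ 2 * H / alpha by rewrite divr_ge0 ?mulr_ge0 ?sqr_ge0//.
  apply: (@le_trans _ _ ((1 - alpha) * ((1 + alpha / 2) * r + 2 * gamma ^+ 2 * H / alpha))).
    rewrite ler_wpM2l ?subr_ge0//; lra.
  have : 0 <= alpha * (2 * gamma ^+ 2 * H / alpha) by rewrite mulr_ge0//.
  have : 0 <= alpha ^+ 2 * r by rewrite mulr_ge0 ?sqr_ge0.
  lra.
have h3 : L * gamma ^+ 2 / 2 * (2 - alpha) * M
    <= L * gamma ^+ 2 * (2 * A * (2 * F + L * r) + B * H + C).
  have L2 : 0 <= L * gamma ^+ 2 by rewrite mulr_ge0 ?sqr_ge0.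
  apply: (@le_trans _ _ (L * gamma ^+ 2 * M)).
    have : 0 <= L * gamma ^+ 2 * M * alpha by rewrite !mulr_ge0//.
    lra.
  by rewrite ler_wpM2l// ME !lerD2r ler_wpM2l ?mulr_ge0.
have h4 : gamma / 2 * (L ^+ 2 * r) <= L / 2 * (alpha / 2 * r).
  have : L * r * (8 * L * gamma) <= L * r * alpha by rewrite ler_wpM2l// mulr_ge0//.
  have : 0 <= L * r * alpha by rewrite !mulr_ge0//.
  lra.
have h5 : L / 2 * (2 * gamma ^+ 2 * H / alpha) <= gamma * H / 8.
  have -> : L / 2 * (2 * gamma ^+ 2 * H / alpha) = gamma * H / 8 * (8 * L * gamma / alpha).
    by field; rewrite gt_eqF.
  rewrite ler_piMr// ?divr_ge0 ?mulr_ge0 //.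
  by rewrite ler_pdivrMr// mul1r.
have h6 : L * gamma ^+ 2 * (B * H) <= gamma * H / 4.
  have : gamma * H / 4 * (4 * B * L * gamma) <= gamma * H / 4.
    by rewrite ler_piMr// divr_ge0 ?mulr_ge0.
  lra.
have h7 : 0 <= gamma * H by rewrite mulr_ge0.
have h2' : L / 2 * ((1 - alpha) * (r - 2 * gamma * c))
    <= L / 2 * ((1 - alpha / 2) * r + 2 * gamma ^+ 2 * H / alpha).
  by rewrite ler_wpM2l// divr_ge0//.
(* The coefficients of [gamma * H] are -1/2 from [h1], 1/8 from [h5] and 1/4 from [h6]. By [h4], the
   term in [r] from [h1] is paid for by the contraction [alpha / 2] of [h2]. The terms in [A] from
   [h3] make up the factor [4 * gamma ^+ 2 * A * L]. *)
lra.
Qed.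

(** Taken as a map of a state and a pair of seeds, to fit the transition [F] of
    [markov_chain_independent]. *)
Definition ef_step (R : realType) (d : nat) (S1 S2 : Type)
    (g : S1 -> 'rV[R]_d -> 'rV[R]_d) (CP : S2 -> 'rV[R]_d -> 'rV[R]_d)
    (gamma : R) (p : (borel_rV R d * borel_rV R d) * (S1 * S2)) :
    borel_rV R d * borel_rV R d :=
  let x' := p.1.1 - gamma *: g p.2.1 p.1.2 in
  (x', p.1.2 + CP p.2.2 (x' - p.1.2)).

Lemma measurable_ef_step (R : realType) (d : nat) (d1 d2 : measure_display)
    (S1 : measurableType d1) (S2 : measurableType d2)
    (g : S1 -> 'rV[R]_d -> 'rV[R]_d) (CP : S2 -> 'rV[R]_d -> 'rV[R]_d)
    (gamma : R) :
  measurable_map g -> measurable_map CP ->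
  measurable_fun setT (ef_step g CP gamma).
Proof.
move=> mg mCP.
pose T := ((borel_rV R d * borel_rV R d) * (S1 * S2))%type.
have mx : measurable_fun setT (fun p : T => p.1.1).
  exact: (measurableT_comp measurable_fst measurable_fst).
have mw : measurable_fun setT (fun p : T => p.1.2).
  exact: (measurableT_comp measurable_snd measurable_fst).
have ms1 : measurable_fun setT (fun p : T => p.2.1).
  exact: (measurableT_comp measurable_fst measurable_snd).
have ms2 : measurable_fun setT (fun p : T => p.2.2).
  exact: (measurableT_comp measurable_snd measurable_snd).
have mx' : measurable_fun setT
    (fun p : T => p.1.1 - gamma *: g p.2.1 p.1.2 : borel_rV R d).
  apply: measurable_funB_rV => //; apply: measurable_funZ_rV.
  exact: (measurableT_comp mg (measurable_fun_pair ms1 mw)).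
apply: measurable_fun_pair => //; apply: measurable_funD_rV => //.
apply: (measurableT_comp mCP (measurable_fun_pair ms2 _)).
exact: measurable_funB_rV.
Qed.

(** The compressor is integrated first, at a fixed gradient sample. By [descent_lemma] a quadratic
    in the sample remains; its expectation is bounded through the two moments, and [one_step_real]
    concludes. *)
Lemma one_step (R : realType) (d : nat) (d1 d2 : measure_display)
    (S1 : measurableType d1) (S2 : measurableType d2)
    (mu1 : probability S1 R) (mu2 : probability S2 R)
    (g : S1 -> 'rV[R]_d -> 'rV[R]_d) (CP : S2 -> 'rV[R]_d -> 'rV[R]_d)
    (f : 'rV[R]_d -> R) (fstar L A B C alpha gamma : R) (x w : 'rV[R]_d) :
  0 < L -> (forall z, differentiable f z) -> lipschitz_gradient f L ->
  (forall z, fstar <= f z) ->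
  measurable_map g -> unbiased_gradient mu1 g f ->
  0 <= A -> 0 <= B -> 0 <= C -> ABC_bound mu1 g f fstar A B C ->
  0 < alpha -> alpha <= 1 -> compressor mu2 CP alpha ->
  0 < gamma -> 8 * L * gamma <= alpha -> 4 * B * L * gamma <= 1 ->
  (\int[mu1]_s1 \int[mu2]_s2
      (lyapunov f fstar L (ef_step g CP gamma ((x, w), (s1, s2))))%:E
    + (gamma / 2 * enorm (gradient f x) ^+ 2)%:E
   <= ((1 + 4 * gamma ^+ 2 * A * L) * lyapunov f fstar L (x, w)
       + L * gamma ^+ 2 * C)%:E)%E.
Proof.
move=> L0 df fL flb mg gE A0 B0 C0 gABC a0 a1 CPc g0 ga gB.
have L0' := ltW L0.
set r := dotv (x - w) (x - w); set H := dotv (gradient f w) (gradient f w).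
(* Coefficients of the quadratic in the sample: [descent_lemma] along [- (gamma *: g s w)] plus
   [L / 2 * (1 - alpha)] times |x - w - gamma g|^2. The factor [2 - alpha] in [K2] is 1 + (1 -
   alpha). *)
pose K0 := f x - fstar + L / 2 * ((1 - alpha) * r).
pose K1 := - (gamma *: gradient f x) - (L * (1 - alpha) * gamma) *: (x - w).
pose K2 := L * gamma ^+ 2 / 2 * (2 - alpha).
pose M := 2 * A * (f w - fstar) + B * H + C.
have mgw : measurable_fun setT (fun s => g s w : borel_rV R d).
  exact: (measurable_fun_pair1 (w : borel_rV R d) mg).
have mF2 : measurable_fun setT (fun s : S1 * S2 =>
    (lyapunov f fstar L (ef_step g CP gamma ((x, w), s)))%:E).
  apply/measurable_EFinP; apply: measurableT_comp.
    exact: measurable_lyapunov.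
  apply: (measurable_fun_pair2 ((x, w) : borel_rV R d * borel_rV R d)).
  exact: measurable_ef_step CPc.1.
apply: (@le_trans _ _ (\int[mu1]_s (K0 + dotv K1 (g s w) + K2 * enorm (g s w) ^+ 2)%:E
    + (gamma / 2 * enorm (gradient f x) ^+ 2)%:E)%E).
  rewrite leeD2r//; apply: ge0_le_integral => //.
  - by move=> s _; apply: integral_ge0 => s2 _; rewrite lee_fin lyapunov_ge0.
  - apply: (measurable_fun_fubini_tonelli_F _ mF2) => s.
    by rewrite lee_fin lyapunov_ge0.
  - apply/measurable_EFinP; apply: measurable_funD; last first.
      by apply: measurable_funM => //; exact: measurable_enorm_sqr.
    apply: measurable_funD => //; apply: measurable_sum => j.
    apply: measurable_funM => //.
    exact: (measurableT_comp (measurable_coord j) mgw).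
  - move=> s _; apply: le_trans (compressor_step (x - gamma *: g s w) w CPc L0' flb) _.
    rewrite /= lee_fin.
    have := descent_lemma x (- (gamma *: g s w)) L0 df fL.
    rewrite /K0 /K1 /K2 !enorm_sqr (_ : x - gamma *: g s w - w = (x - w) - gamma *: g s w).
      rewrite /r; move: (x - w) (g s w) => u v.
      rewrite !dotvE (dotvC v u); lra.
    by rewrite addrAC.
have XM : (\int[mu1]_s (enorm (g s w) ^+ 2)%:E <= M%:E)%E.
  by have := gABC w; rewrite unlock enorm_sqr.
have Xm j : (\int[mu1]_s (g s w 0 j)%:E = (gradient f w 0 j)%:E)%E.
  by have := gE w j; rewrite unlock.
have K20 : 0 <= K2.
  by apply: mulr_ge0; [rewrite divr_ge0// mulr_ge0// sqr_ge0 | lra].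
apply: le_trans (leeD2r _ (expectation_quadratic_le K1 K0 mgw Xm XM K20)) _.
rewrite -EFinD lee_fin /lyapunov/= !enorm_sqr -/r.
pose F := f x - fstar; pose G := dotv (gradient f x) (gradient f x).
pose p := dotv (gradient f x) (gradient f w).
pose c := dotv (x - w) (gradient f w).
have gx2 : G <= 2 * L * F by rewrite /G -enorm_sqr; exact: gradient_sqr_le.
(* Descent from [x] to [w]; the inner product of grad f x with w - x is at most G/(2L) + L r/2 by
   Young, and G/(2L) <= F by [gx2]. *)
have fw : f w - fstar <= 2 * F + L * r.
  have := descent_lemma x (w - x) L0 df fL; rewrite addrC subrK.
  have -> : dotv (w - x) (w - x) = r.
    by rewrite /r -(opprB x w) dotvNl dotvNr opprK.
  have := dotvv_ge0 (gradient f x - L *: (w - x)).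
  have -> : dotv (gradient f x - L *: (w - x)) (gradient f x - L *: (w - x))
     = G - 2 * L * dotv (gradient f x) (w - x) + L ^+ 2 * r.
    rewrite /r -(opprB w x) /G; move: (w - x) => u.
    by rewrite !dotvE (dotvC u); ring.
  move=> h1 h2; rewrite -(ler_pM2l L0).
  have h3 : 2 * L * dotv (gradient f x) (w - x) <= 2 * L * F + L ^+ 2 * r by lra.
  have := ler_wpM2l L0' h2; rewrite /F in h3 *; lra.
have := @one_step_real R F (f w - fstar) G H
  (dotv (gradient f x - gradient f w) (gradient f x - gradient f w))
  r p c M L A B C alpha gamma L0 g0 a0 a1 A0 B0 C0 ga gB.
rewrite dotvv_ge0 dotvv_ge0 subr_ge0 flb.
move=> /(_ isT isT isT (lipschitz_gradient_sqr x w fL)) h.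
apply: le_trans (h _ _ fw erefl).
- rewrite /K0 /K1 /K2 -/F -/G !(dotvDl (- _)) !dotvNl !dotvZl -/p -/c; lra.
- by rewrite !dotvE (dotvC (gradient f w)) /G /H /p; ring.
(* This square is the Young inequality behind the cross term [c]. *)
- have := dotvv_ge0 ((alpha / 2) *: (x - w) + gamma *: gradient f w).
  rewrite dotvDl !dotvDr !dotvZl !dotvZr -/r -/H (dotvC (gradient f w)) -/c.
  by move/le_trans; apply; lra.
Qed.

(** * The stepsize formula and its consequences *)

Lemma efrac_le (R : realType) (a b c : R) :
  0 <= a -> 0 <= b -> (c%:E <= efrac a b)%E -> c * b <= a.
Proof.
(* A zero denominator gives [+oo] and no information on [c], but the claim is then [0 <= a]. *)
rewrite /efrac => a0 b0; case: eqP => [->|/eqP b_neq0]; first by rewrite mulr0.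
by rewrite lee_fin ler_pdivlMr// lt_def b_neq0.
Qed.

Lemma efrac_eq (R : realType) (a b c : R) : c%:E = efrac a b -> c * b = a.
Proof.
by rewrite /efrac; case: eqP => // /eqP b_neq0 [->]; rewrite divfK.
Qed.

Lemma efrac_gt0 (R : realType) (a b : R) :
  0 < a -> 0 <= b -> (0 < efrac a b)%E.
Proof.
rewrite /efrac => a0 b0; case: eqP => [//|/eqP b_neq0].
by rewrite lte_fin divr_gt0// lt_def b_neq0.
Qed.

(** The upper bounds on [gamma] hold since it is at most each fraction. For the last conclusion,
    [gamma] equals one of the four fractions, and the matching entry of the maximum in the bound on
    [T] is used. *)
Lemma stepsize_bounds (R : realType) (alpha eps A B C L : R) (T : nat)
    (gamma Delta0 : R) :
  0 < L -> 0 < alpha -> 0 < eps -> 0 <= A -> 0 <= B -> 0 <= C ->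
  0 <= Delta0 -> stepsize alpha eps A B C L T gamma ->
  48 * Delta0 * L / eps
    * Num.max (8 / alpha)
        (Num.max (4 * B)
          (Num.max (96 * Delta0 * A / eps) (16 * C / eps))) <= T%:R ->
  [/\ 0 < gamma, 8 * L * gamma <= alpha /\ 4 * B * L * gamma <= 1,
      2 * A * L * T%:R * gamma ^+ 2 <= 1, 16 * C * L * gamma <= eps
    & 48 * Delta0 <= eps * gamma * T%:R].
Proof.
move=> L0 a0 e0 A0 B0 C0 D0 [_ gE] Tge.
have L0' := ltW L0; have e0' := ltW e0.
have ALT0 : 0 <= 2 * A * L * T%:R by rewrite !mulr_ge0.
have e1 : (0 < efrac alpha (8 * L))%E by rewrite efrac_gt0// mulr_ge0.
have e2 : (0 < efrac 1 (4 * B * L))%E by rewrite efrac_gt0// !mulr_ge0.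
have e3 : (0 < efrac 1 (Num.sqrt (2 * A * L * T%:R)))%E.
  by rewrite efrac_gt0// sqrtr_ge0.
have e4 : (0 < efrac eps (16 * C * L))%E by rewrite efrac_gt0// !mulr_ge0.
(* The first fraction is finite because [L > 0], hence so is the minimum. *)
have gm : gamma%:E = stepsize_min alpha eps A B C L T.
  apply: gE; apply/eqP; rewrite /stepsize_min minEle; apply/eqP.
  have : efrac alpha (8 * L) <> +oo%E by rewrite /efrac mulf_eq0 gt_eqF// gt_eqF.
  by case: ifPn => // + h1 h2; rewrite h2 leey.
have g0 : 0 < gamma by rewrite -lte_fin gm !lt_min e1 e2 e3 e4.
have := lexx gamma%:E; rewrite {2}gm !le_min => /and4P[].
move=> /efrac_le-/(_ (ltW a0) (mulr_ge0 _ L0')) h1.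
move=> /efrac_le-/(_ ler01 (mulr_ge0 (mulr_ge0 _ B0) L0')) h2.
move=> /efrac_le-/(_ ler01 (sqrtr_ge0 _)) h3.
move=> /efrac_le-/(_ e0' (mulr_ge0 (mulr_ge0 _ C0) L0')) h4.
have sqrt2 : Num.sqrt (2 * A * L * T%:R) ^+ 2 = 2 * A * L * T%:R by rewrite sqr_sqrtr.
split => //; first by rewrite !(mulrC _ gamma) h1// h2.
- rewrite -sqrt2 -exprMn mulrC expr_le1 ?mulr_ge0 ?sqrtr_ge0 ?(ltW g0)//.
- by rewrite mulrC h4.
have key q : 48 * Delta0 * L / eps * q <= T%:R ->
    48 * Delta0 * (L * gamma * q) <= eps * gamma * T%:R.
  move=> /(ler_wpM2l (mulr_ge0 e0' (ltW g0))); apply: le_trans.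
  by rewrite le_eqVlt; apply/orP; left; apply/eqP; field; rewrite gt_eqF.
have c0 : 0 <= 48 * Delta0 * L / eps by rewrite divr_ge0// !mulr_ge0.
move: Tge; rewrite !maxr_pMr// !ge_max => /and4P[/key k1 /key k2 k3 /key k4].
move: gm; rewrite /stepsize_min /mine.
case: ifP => _; [|case: ifP => _; [|case: ifP => _]] => /efrac_eq g_eq.
- apply: le_trans k1; rewrite le_eqVlt; apply/orP; left; apply/eqP.
  by rewrite -g_eq; field; rewrite gt_eqF//= gt_eqF.
- apply: le_trans k2; rewrite (_ : L * gamma * (4 * B) = gamma * (4 * B * L)).
    by rewrite g_eq mulr1.
  ring.
(* Here [gamma] is an inverse square root, so squares are compared:
   [2 * A * L * T%:R * gamma ^+ 2 = 1] turns (48 Delta0)^2 into 48 * 96 Delta0^2 A L T gamma^2,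
   which accounts for the constant 96. *)
- rewrite -(@ler_pXn2r _ 2)// ?nnegrE ?mulr_ge0// ?(ltW g0)//.
  have k3' := ler_wpM2l (sqr_ge0 eps) k3.
  have E : eps ^+ 2 * (48 * Delta0 * L / eps * (96 * Delta0 * A / eps))
     = 48 * 96 * Delta0 ^+ 2 * (A * L) by field; rewrite gt_eqF.
  rewrite E in k3'.
  have := ler_wpM2l (mulr_ge0 (sqr_ge0 gamma) (ler0n R T)) k3'.
  have : gamma ^+ 2 * (2 * A * L * T%:R) = 1 by rewrite -sqrt2 -exprMn g_eq expr1n.
  move=> h h'.
  have -> : (48 * Delta0) ^+ 2 = 48 ^+ 2 * Delta0 ^+ 2 * (gamma ^+ 2 * (2 * A * L * T%:R)).
    by rewrite h mulr1 exprMn.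
  apply: le_trans (le_trans h' _).
    by rewrite le_eqVlt; apply/orP; left; apply/eqP; ring.
  by rewrite le_eqVlt; apply/orP; left; apply/eqP; ring.
- apply: le_trans k4; rewrite le_eqVlt; apply/orP; left; apply/eqP.
  have -> : L * gamma * (16 * C / eps) = gamma * (16 * C * L) / eps by field; rewrite gt_eqF.
  by rewrite g_eq divff ?mulr1// gt_eqF.
Qed.

(** * The drift inequality over [T] steps *)

Lemma lyapunov_argument (R : realFieldType) (T : nat) (V G : nat -> R)
    (a b eps gamma : R) :
  (0 < T)%N -> 0 < gamma -> 0 < eps -> 0 <= a ->
  (forall t, 0 <= V t) ->
  (forall t, V t.+1 + gamma / 2 * G t <= (1 + a) * V t + b) ->
  a * T%:R <= 2 -> 16 * b <= gamma * eps ->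
  48 * V 0%N <= eps * gamma * T%:R ->
  exists2 t : nat, (t < T)%N & G t <= eps.
Proof.
move=> T0 g0 e0 a0 V0 VS aT bge V0le.
have ge0 : 0 < gamma * eps by rewrite mulr_gt0.
have aV0 : 48 * (a * V 0%N) <= 2 * (gamma * eps).
  have h1 := ler_wpM2l a0 V0le.
  have h2 := ler_wpM2l (ltW ge0) aT; lra.
apply: contrapT => /forall2NP noG.
have Gt t : (t < T)%N -> eps < G t.
  by move=> tT; case: (noG t) => // /negP; rewrite -ltNge.
(* Since the induction keeps [V t <= V 0%N], the growth [a * V t] is at most gamma eps / 24 and no
   power of 1 + a builds up. As b <= gamma eps / 16, each step gains 1/2 - 1/24 - 1/16 = 19/48 of
   gamma eps. *)
have Vt t : (t <= T)%N -> V t <= V 0%N - t%:R * (gamma * eps * (19 / 48)).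
  elim: t => [|t IH] tT; first by rewrite mul0r subr0.
  have := IH (ltnW tT) => Vle.
  have VV0 : V t <= V 0%N.
    by apply: (le_trans Vle); rewrite gerBl mulr_ge0//; lra.
  have h1 := ler_wpM2l a0 VV0.
  have h2 : gamma * eps <= gamma * G t by rewrite ler_wpM2l// ltW// Gt.
  have := VS t; rewrite -(natr1 t); lra.
have := Vt T (leqnn T); have := V0 T => VT0 VT.
have : 0 < T%:R * (gamma * eps) by rewrite mulr_gt0// ltr0n.
lra.
Qed.

(** The inequality is kept free of subtraction: with nonnegative terms on both sides, integrals add
    up in [0, +oo] even before they are known to be finite. *)
Lemma ge0_integral_drift (R : realType) (dO : measure_display)
    (Omega : measurableType dO) (P : probability Omega R)
    (h G v : Omega -> \bar R) (c k b : R) :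
  0 <= c -> 0 <= k -> 0 <= b ->
  measurable_fun setT h -> (forall o, 0 <= h o)%E ->
  measurable_fun setT G -> (forall o, 0 <= G o)%E ->
  measurable_fun setT v -> (forall o, 0 <= v o)%E ->
  (forall o, h o + c%:E * G o <= k%:E * v o + b%:E)%E ->
  (\int[P]_o h o + c%:E * \int[P]_o G o <= k%:E * \int[P]_o v o + b%:E)%E.
Proof.
move=> c0 k0 b0 mh h0 mG G0 mv v0 hGv.
have mcG : measurable_fun setT (fun o => c%:E * G o)%E.
  exact: measurable_funeM.
have mkv : measurable_fun setT (fun o => k%:E * v o)%E.
  exact: measurable_funeM.
have cG0 o : (0 <= c%:E * G o)%E by rewrite mule_ge0.
have kv0 o : (0 <= k%:E * v o)%E by rewrite mule_ge0.
have -> : (b%:E = \int[P]_o cst b%:E o)%E.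
  by rewrite integral_cst//= probability_setT mule1.
rewrite -ge0_integralZl_EFin// -ge0_integralD//.
rewrite -ge0_integralZl_EFin// -ge0_integralD//.
apply: ge0_le_integral => //.
- by move=> o _; rewrite adde_ge0.
- exact: emeasurable_funD.
- exact: emeasurable_funD.
Qed.

(** * The degenerate case [L = 0] and the convergence of the trajectory *)

Lemma lipschitz0_gradient_eq0 (R : realType) (d : nat) (f : 'rV[R]_d -> R)
    (fstar : R) (x : 'rV[R]_d) :
  (forall z, differentiable f z) -> lipschitz_gradient f 0 ->
  (forall z, fstar <= f z) -> enorm (gradient f x) ^+ 2 = 0.
Proof.
move=> df f0 flb; apply/eqP; rewrite eq_le sqr_ge0 andbT leNgt; apply/negP => N0.
have D1 : 0 < f x - fstar + 1 by rewrite ltr_wpDl// subr_ge0.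
(* With Lipschitz constant 0, every positive number is one as well. This choice makes
   [2 * L * (f x - fstar + 1)] equal to the squared gradient, which [gradient_sqr_le] contradicts by
   the margin of 1. *)
pose L := enorm (gradient f x) ^+ 2 / (2 * (f x - fstar + 1)).
have L0 : 0 < L by rewrite divr_gt0// mulr_gt0.
have fL : lipschitz_gradient f L.
  by move=> y z; rewrite (le_trans (f0 y z))// mul0r mulr_ge0 ?sqrtr_ge0 ?(ltW L0).
have := gradient_sqr_le x L0 df fL flb.
have -> : enorm (gradient f x) ^+ 2 = 2 * L * (f x - fstar + 1).
  by rewrite /L; field; rewrite gt_eqF.
lra.
Qed.

Unset Implicit Arguments.

Theorem theoremE3 (R : realType) (d n : nat) (n_gt0 : (0 < n)%N)
  (fi : 'I_n -> 'rV[R]_d -> R) (f : 'rV[R]_d -> R)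
  (f_avg : forall x, f x = n%:R^-1 * \sum_(i < n) fi i x)
  (L : R) (f_smooth : smooth_with_constant f L)
  (fstar : R) (fistar : 'I_n -> R)
  (f_lb : forall x, fstar <= f x)
  (fi_lb : forall i x, fistar i <= fi i x)
  (d1 d2 dO : measure_display)
  (* the stochastic gradient *)
  (S1 : measurableType d1) (mu1 : probability S1 R)
  (g : S1 -> 'rV[R]_d -> 'rV[R]_d)
  (g_meas : measurable_map g)
  (g_unbiased : unbiased_gradient mu1 g f)
  (A B C : R) (A_ge0 : 0 <= A) (B_ge0 : 0 <= B) (C_ge0 : 0 <= C)
  (g_ABC : ABC_bound mu1 g f fstar A B C)
  (* the compressor *)
  (alpha : R) (alpha_gt0 : 0 < alpha) (alpha_le1 : alpha <= 1)
  (S2 : measurableType d2) (mu2 : probability S2 R)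
  (CP : S2 -> 'rV[R]_d -> 'rV[R]_d)
  (CP_compressor : compressor mu2 CP alpha)
  (* the randomness drawn along the iterations *)
  (Omega : measurableType dO) (P : probability Omega R)
  (xi : nat -> {RV P >-> S1}) (zeta : nat -> {RV P >-> S2})
  (xi_law : forall t, has_law mu1 (xi t))
  (zeta_law : forall t, has_law mu2 (zeta t))
  (indep : mutually_independent P (seed_events xi zeta))
  (eps : R) (eps_gt0 : 0 < eps) (T : nat) (T_ge1 : (1 <= T)%N)
  (gamma : R) (gammaE : stepsize alpha eps A B C L T gamma)
  (x0 : 'rV[R]_d) (x w : nat -> Omega -> 'rV[R]_d)
  (x_init : forall o, x 0%N o = x0)
  (w_init : forall o, w 0%N o = x0)
  (x_step : forall t o, x t.+1 o = x t o - gamma *: g (xi t o) (w t o))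
  (w_step : forall t o,
     w t.+1 o = w t o + CP (zeta t o) (x t.+1 o - w t o)) :
  let Delta0 := f x0 - fstar in
  48 * Delta0 * L / eps
    * Num.max (8 / alpha)
        (Num.max (4 * B)
          (Num.max (96 * Delta0 * A / eps) (16 * C / eps))) <= T%:R ->
  (\big[mine/+oo]_(t < T) 'E_P[fun o => (enorm (gradient f (x t o)) ^+ 2)%R]
    <= eps%:E)%E.
Proof.
move=> Delta0 Tge; have [df L0 fL _] := f_smooth.
have D0 : 0 <= Delta0 by rewrite subr_ge0.
(* If [L = 0], the gradient vanishes everywhere and the term of index 0, present because [T >= 1],
   is 0. *)
move: L0; rewrite le_eqVlt => /predU1P[L0|L_gt0].
  have G0 z : enorm (gradient f z) ^+ 2 = 0.
    by apply: (@lipschitz0_gradient_eq0 _ _ _ fstar) => //; rewrite L0.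
  apply: (le_trans (bigmin_le_cond _ _ (isT : xpredT (Ordinal T_ge1)))).
  rewrite unlock; under eq_integral do rewrite G0.
  by rewrite integral0 lee_fin ltW.
have L_ge0 := ltW L_gt0.
have [g0 [ga gB] gT gC gD] := stepsize_bounds L_gt0 alpha_gt0 eps_gt0 A_ge0
  B_ge0 C_ge0 D0 gammaE Tge.
pose F := ef_step g CP gamma.
pose Z t o : borel_rV R d * borel_rV R d := (x t o, w t o).
have mF : measurable_fun setT F by exact: measurable_ef_step CP_compressor.1.
have Z0 o : Z 0%N o = (x0, x0) by rewrite /Z x_init w_init.
have ZS t o : Z t.+1 o = F (Z t o, (xi t o, zeta t o)).
  by rewrite /Z /F /ef_step/= w_step x_step.
have mZ t : measurable_fun setT (Z t).
  by have [] := markov_chain_independent t xi_law zeta_law indep mF Z0 ZS.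
pose lyap z := (lyapunov f fstar L z)%:E.
have lyap0 z : (0 <= lyap z)%E by rewrite lee_fin lyapunov_ge0.
have mlyap : measurable_fun setT lyap.
  by apply/measurable_EFinP; exact: measurable_lyapunov.
pose V t := (\int[P]_o lyap (Z t o))%E.
pose G t := (\int[P]_o (enorm (gradient f (x t o)) ^+ 2)%:E)%E.
pose a := 4 * gamma ^+ 2 * A * L; pose b := L * gamma ^+ 2 * C.
have a0 : 0 <= a by rewrite !mulr_ge0 ?sqr_ge0 ?(ltW g0)//.
have b0 : 0 <= b by rewrite !mulr_ge0 ?sqr_ge0 ?(ltW g0)//.
have mG t : measurable_fun setT (fun o => (enorm (gradient f (x t o)) ^+ 2)%:E).
  apply/measurable_EFinP; apply: measurable_enorm_sqr.
  apply: (measurableT_comp (measurable_gradient L_ge0 fL)).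
  exact: (measurableT_comp measurable_fst (mZ t)).
have VS t : (V t.+1 + (gamma / 2)%:E * G t <= (1 + a)%:E * V t + b%:E)%E.
  have mlyapF : measurable_fun setT (lyap \o F) by exact: measurableT_comp.
  pose h z := (\int[mu1]_s1 \int[mu2]_s2 lyap (F (z, (s1, s2))))%E.
  have h0 z : (0 <= h z)%E.
    by apply: integral_ge0 => s1 _; exact: integral_ge0.
  have mh : measurable_fun setT h.
    exact: (measurable_iterated_integral mu1 mu2 mlyapF (fun z => lyap0 (F z))).
  rewrite /V (ge0_integral_markov_chain (h := lyap) t xi_law zeta_law indep mF Z0 ZS)//.
  have mhZ : measurable_fun setT (fun o => h (Z t o)).
    exact: (measurableT_comp mh (mZ t)).
  have mlZ : measurable_fun setT (fun o => lyap (Z t o)).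
    exact: measurableT_comp.
  apply: (@ge0_integral_drift _ _ _ P (fun o => h (Z t o))
    (fun o => (enorm (gradient f (x t o)) ^+ 2)%:E) (fun o => lyap (Z t o))) => //.
  - by rewrite divr_ge0// ltW.
  - by rewrite addr_ge0.
  - by move=> o; rewrite lee_fin sqr_ge0.
  - move=> o; rewrite -!EFinM -EFinD.
    exact: (@one_step _ _ _ _ _ _ mu1 mu2 g CP f fstar L A B C alpha gamma).
have V_ge0 t : (0 <= V t)%E by apply: integral_ge0.
have G_ge0 t : (0 <= G t)%E by apply: integral_ge0 => o _; rewrite lee_fin sqr_ge0.
(* Both sequences start at [x0], so the distance term vanishes. *)
have V0 : V 0%N = Delta0%:E.
  rewrite /V; under eq_integral do rewrite Z0.
  rewrite integral_cst//= probability_setT mule1 /lyap /lyapunov/= subrr.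
  rewrite enorm_sqr (_ : dotv 0 0 = 0) ?mulr0 ?addr0//.
  by rewrite /dotv big1// => i _; rewrite mxE mul0r.
have g2 : 0 < gamma / 2 by rewrite divr_gt0.
(* Finiteness propagates from [V 0%N] through the drift inequality, which also bounds [G t] since
   [gamma / 2 > 0]; afterwards the recursion can be read in the reals. *)
have VfinS t : V t \is a fin_num -> (V t.+1 < +oo)%E /\ (G t < +oo)%E.
  move=> Vt; have rhs : ((1 + a)%:E * V t + b%:E < +oo)%E.
    by rewrite -(fineK Vt) -EFinM -EFinD ltry.
  have := le_lt_trans (VS t) rhs.
  have gG : (0 <= (gamma / 2)%:E * G t)%E by rewrite mule_ge0// lee_fin ltW.
  move=> lhs; split; first by apply: le_lt_trans lhs; rewrite leeDl.
  have : ((gamma / 2)%:E * G t < +oo)%E by apply: le_lt_trans lhs; rewrite leeDr.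
  case: (G t) (G_ge0 t) => [r _ _|_|//]; first exact: ltry.
  by rewrite gt0_muley// lte_fin.
have Vfin t : V t \is a fin_num.
  elim: t => [|t /VfinS[Vt _]]; first by rewrite V0.
  by rewrite ge0_fin_numE.
have Gfin t : G t \is a fin_num.
  by rewrite ge0_fin_numE//; have [] := VfinS t (Vfin t).
have [t tT Gt] : exists2 t : nat, (t < T)%N & fine (G t) <= eps.
  apply: (@lyapunov_argument _ T (fine \o V) (fine \o G) a b eps gamma) => //=.
  - by move=> t; rewrite fine_ge0.
  - move=> t; have := VS t.
    by rewrite -(fineK (Vfin t.+1)) -(fineK (Vfin t)) -(fineK (Gfin t)) -!EFinM
      -!EFinD lee_fin.
  - by rewrite /a; lra.
  - by rewrite /b; have := ler_wpM2l (ltW g0) gC; lra.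
  - by rewrite V0.
apply: (le_trans (bigmin_le_cond _ _ (isT : xpredT (Ordinal tT)))).
by rewrite unlock/= -[leLHS]/(G t) -(fineK (Gfin t)) lee_fin.
Qed.
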